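(* Let $\mathcal V$ be a variety of algebras. For each natural number $k$ the following conditions are equivalent, and $\mathcal V$ is congruence distributive if and only if there is some $k$ for which any one of them holds. (i) $\mathcal V$ satisfies the congruence identity $$\alpha(\beta\circ\gamma\circ\beta)\subseteq\alpha\beta\circ_k\gamma. \qquad ( * )$$ (ii) The identity $( * )$ holds (for all congruences $\alpha,\beta,\gamma$) in $\mathbf F_{\mathcal V}(4)$, the free algebra in $\mathcal V$ generated by four elements $x,y,z,w$; actually, it is equivalent to assume that the inclusion $( * )$ holds in $\mathbf F_{\mathcal V}(4)$ in the special case when $\alpha=Cg(x,w)$, $\beta=Cg((x,y),(z,w))$ and $\gamma=Cg(y,z)$. (iii) $\mathcal V$ has $4$-ary terms $d_0,\dots,d_k$ such that the following equations are valid in $\mathcal V$ (where in (b)-(d) the index $i$ ranges over $0\le i<k$): (a) $x=d_0(x,y,z,w)$; (b) $d_i(x,x,w,w)=d_{i+1}(x,x,w,w)$, for $i$ even; (c) $d_i(x,y,z,x)=d_{i+1}(x,y,z,x)$, for $i$ even; (d) $d_i(x,y,y,w)=d_{i+1}(x,y,y,w)$, for $i$ odd; (e) $d_k(x,y,z,w)=w$.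
   Context: A variety is congruence distributive if the congruence lattice of each of its algebras is distributive. Juxtaposition of binary relations denotes intersection ($\alpha\beta=\alpha\cap\beta$), $\circ$ is relational composition ($a\mathrel{(R\circ S)}b$ iff there is $c$ with $a\mathrel R c\mathrel S b$), and $R\circ_k S$ denotes $R\circ S\circ R\circ S\circ\cdots$ with $k$ alternating factors, starting with $R$ ($k-1$ occurrences of $\circ$; $k\ge 1$). In particular $\alpha\beta\circ_k\gamma$ means $(\alpha\cap\beta)\circ_k\gamma$. A variety satisfies a congruence identity if the inclusion holds for all algebras $\mathbf A\in\mathcal V$ and all congruences $\alpha,\beta,\gamma$ of $\mathbf A$. $Cg(a,b)$ is the congruence generated by the pair $(a,b)$, and $Cg((a,b),(c,d))$ is the congruence generated by the two pairs $(a,b)$ and $(c,d)$. *)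

(* Defs.v *)
From mathcomp Require Import all_boot.
From mathcomp Require Import boolp classical_sets.

Set Implicit Arguments.
Unset Strict Implicit.
Unset Printing Implicit Defensive.

Local Open Scope classical_set_scope.

(* Algebras of a fixed finitary type: [symb] is an arbitrary, possibly infinite
   or empty, collection of operation symbols, constants included. *)
Record signature := Signature { symb : Type; arity : symb -> nat }.

Record algebra (Sg : signature) := Algebra {
  carrier :> Type;
  interp : forall f : symb Sg, ('I_(arity f) -> carrier) -> carrier }.

Definition hom (Sg : signature) (A B : algebra Sg) (h : A -> B) : Prop :=
  forall (f : symb Sg) (a : 'I_(arity f) -> A),
    h (interp a) = interp (fun i => h (a i)).

Definition prod_algebra (Sg : signature) (I : Type) (F : I -> algebra Sg) :
    algebra Sg :=
  @Algebra Sg (forall i, F i) (fun f a i => interp (fun j => a j i)).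

(* A variety is a class of nonempty algebras closed under homomorphic images,
   subalgebras and products. Subalgebras are given up to isomorphism, as
   injective homomorphisms (closure under isomorphism is part of closure under
   homomorphic images). The index type of a product may be empty, so every
   variety contains a one-element algebra. *)
Record variety (Sg : signature) := Variety {
  in_variety :> algebra Sg -> Prop;
  variety_nonempty : forall A : algebra Sg, in_variety A -> inhabited A;
  variety_image : forall (A B : algebra Sg) (h : A -> B),
    hom h -> (forall b, exists a, h a = b) -> in_variety A -> in_variety B;
  variety_sub : forall (A B : algebra Sg) (h : A -> B),
    hom h -> injective h -> inhabited A -> in_variety B -> in_variety A;
  variety_prod : forall (I : Type) (F : I -> algebra Sg),
    (forall i, in_variety (F i)) -> in_variety (prod_algebra F) }.

Definition congruence (Sg : signature) (A : algebra Sg) (R : set (A * A)) :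
    Prop :=
  [/\ forall a, R (a, a),
      forall a b, R (a, b) -> R (b, a),
      forall a b c, R (a, b) -> R (b, c) -> R (a, c)
    & forall (f : symb Sg) (a b : 'I_(arity f) -> A),
        (forall i, R (a i, b i)) -> R (interp a, interp b)].

Definition Cg (Sg : signature) (A : algebra Sg) (E : set (A * A)) :
    set (A * A) :=
  smallest (@congruence Sg A) E.

(* In the congruence lattice the meet is the intersection, and the join is the
   congruence generated by the union. *)
Definition cong_join (Sg : signature) (A : algebra Sg) (R S : set (A * A)) :
    set (A * A) :=
  Cg (R `|` S).

Definition congruence_distributive (Sg : signature) (V : variety Sg) : Prop :=
  forall A : algebra Sg, V A ->
  forall alpha beta gamma : set (A * A),
    congruence alpha -> congruence beta -> congruence gamma ->
    alpha `&` cong_join beta gamma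
      = cong_join (alpha `&` beta) (alpha `&` gamma).

(* Composition from left to right, hence the swap with respect to the
   notation of classical_sets. *)
Definition rcomp (T : Type) (R S : set (T * T)) : set (T * T) :=
  (S \; R)%relation.

(* R o S o R o ... with k alternating factors. The case k = 0, which the
   theorem does not use, is the identity relation, so that the last factor
   appears composed with equality. *)
Fixpoint rcomp_alt (T : Type) (R S : set (T * T)) (k : nat) : set (T * T) :=
  if k is k'.+1 then rcomp R (rcomp_alt S R k') else diagonal.

(* alpha (beta o gamma o beta) <= alpha beta o_k gamma *)
Definition star (Sg : signature) (A : algebra Sg) (k : nat)
    (alpha beta gamma : set (A * A)) : Prop :=
  alpha `&` rcomp beta (rcomp gamma beta)
    `<=` rcomp_alt (alpha `&` beta) gamma k.

Definition star_holds_in (Sg : signature) (A : algebra Sg) (k : nat) : Prop :=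
  forall alpha beta gamma : set (A * A),
    congruence alpha -> congruence beta -> congruence gamma ->
    star k alpha beta gamma.

Inductive term (Sg : signature) (X : Type) : Type :=
| Var of X
| App (f : symb Sg) of ('I_(arity f) -> term Sg X).

Arguments Var {Sg X} x.
Arguments App {Sg X} f args.

Definition term_algebra (Sg : signature) (X : Type) : algebra Sg :=
  @Algebra Sg (term Sg X) (fun f args => App f args).

Fixpoint eval (Sg : signature) (X : Type) (A : algebra Sg) (v : X -> A)
    (t : term Sg X) : A :=
  match t with
  | Var x => v x
  | App f args => interp (fun i => eval v (args i))
  end.

(* The quotient A / R: its elements are the classes of R, as subsets of A.
   [class_rep] picks an arbitrary representative; by [hom_class] the
   operations do not depend on it when R is a congruence. *)
Definition quot (Sg : signature) (A : algebra Sg) (R : set (A * A)) : Type :=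
  {P : set A | exists a, P = [set b | R (a, b)]}.

Definition class (Sg : signature) (A : algebra Sg) (R : set (A * A)) (a : A) :
    quot R :=
  exist _ [set b | R (a, b)] (ex_intro _ a erefl).

Definition class_rep (Sg : signature) (A : algebra Sg) (R : set (A * A))
    (P : quot R) : A :=
  sval (cid (svalP P)).

Definition quot_algebra (Sg : signature) (A : algebra Sg) (R : set (A * A)) :
    algebra Sg :=
  @Algebra Sg (quot R)
    (fun f P => class R (interp (fun i => class_rep (P i)))).

Lemma quot_inj (Sg : signature) (A : algebra Sg) (R : set (A * A))
    (P Q : quot R) : sval P = sval Q -> P = Q.
Proof. by case: P Q => [P p] [Q q] /= E; case: Q / E q => q; congr exist. Qed.

Lemma classP (Sg : signature) (A : algebra Sg) (R : set (A * A)) (a b : A) :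
  congruence R -> class R a = class R b <-> R (a, b).
Proof.
case=> Rr Rs Rt _; split=> [/(congr1 sval) /= E | Rab].
  by have : [set c | R (b, c)] b by []; rewrite -E.
apply: quot_inj; rewrite predeqE => c /=; split.
  exact: Rt (Rs _ _ Rab).
exact: Rt Rab.
Qed.

Lemma class_repK (Sg : signature) (A : algebra Sg) (R : set (A * A))
    (P : quot R) : class R (class_rep P) = P.
Proof. by apply: quot_inj; rewrite /class_rep; case: cid => a /= ->. Qed.

Lemma hom_class (Sg : signature) (A : algebra Sg) (R : set (A * A)) :
  congruence R -> @hom Sg A (quot_algebra R) (class R).
Proof.
move=> cR f a; apply/classP => //; case: (cR) => _ _ _; apply=> i.
by apply/classP => //; rewrite class_repK.
Qed.

(* The identities s = t in the variables X which are valid in V. *)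
Definition identities (Sg : signature) (V : variety Sg) (X : Type) :
    set (term_algebra Sg X * term_algebra Sg X) :=
  [set st | forall A : algebra Sg, V A ->
            forall v : X -> A, eval v st.1 = eval v st.2].

Definition free_algebra (Sg : signature) (V : variety Sg) (X : Type) :
    algebra Sg :=
  quot_algebra (@identities Sg V X).

Definition free_gen (Sg : signature) (V : variety Sg) (X : Type) (x : X) :
    free_algebra V X :=
  class (@identities Sg V X) (Var x : term_algebra Sg X).

Variant letter := lx | ly | lz | lw.

Definition F4 (Sg : signature) (V : variety Sg) : algebra Sg :=
  free_algebra V letter.

Definition star_special (Sg : signature) (V : variety Sg) (k : nat) : Prop :=
  let x := free_gen V lx in
  let y := free_gen V ly in
  let z := free_gen V lz in
  let w := free_gen V lw in
  @star Sg (F4 V) k (Cg [set (x, w)]) (Cg [set (x, y); (z, w)])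
    (Cg [set (y, z)]).

Definition term4 (Sg : signature) := term Sg letter.

Definition app4 (Sg : signature) (A : algebra Sg) (t : term4 Sg)
    (x y z w : A) : A :=
  eval (fun l => match l with lx => x | ly => y | lz => z | lw => w end) t.

(* Only the values d 0, ..., d k matter. *)
Definition chain_terms (Sg : signature) (V : variety Sg) (k : nat)
    (d : nat -> term4 Sg) : Prop :=
  forall A : algebra Sg, V A -> forall x y z w : A,
  [/\ x = app4 (d 0) x y z w,
      forall i, i < k -> ~~ odd i ->
        app4 (d i) x x w w = app4 (d i.+1) x x w w,
      forall i, i < k -> ~~ odd i ->
        app4 (d i) x y z x = app4 (d i.+1) x y z x,
      forall i, i < k -> odd i ->
        app4 (d i) x y y w = app4 (d i.+1) x y y w
    & app4 (d k) x y z w = w].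

(* Main.v *)
Require Import Defs.
From mathcomp Require Import all_boot.
From mathcomp Require Import boolp classical_sets.

(** The conditions for a fixed [k] are a Maltsev condition.  The pair [(x, w)]
    belongs to the left-hand side of the inclusion for the three congruences of
    the free algebra named in the theorem, so the inclusion yields a chain of
    elements of the free algebra, that is, of 4-ary terms
    ([chain_terms_of_rcomp_alt]); the equations among the terms say that
    consecutive elements are related by the appropriate generated congruence.
    Conversely, substituting the elements of any instance of the left-hand side
    into the terms produces the chain required by the right-hand side
    ([chain_terms_star]).

    If congruences distribute, then [(x, w)] is in the join of
    [alpha beta] and [alpha gamma], hence it is linked by a finite alternating
    chain ([cong_join_alt]), whose length is the [k] wanted.

    The substantial direction is from the terms to distributivity, since the
    odd steps of the chain are not in [alpha].  It has three stages.
    - The equations imply [d_i(x,y,y,x) = x], so the [d_i] are Day terms, and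
      Day's argument gives modularity of congruences
      ([chain_terms_modular]).
    - The inclusion puts [alpha (beta o gamma)] inside the join of
      [alpha beta] and [gamma], and modularity then puts it inside the join of
      [alpha beta] and [alpha gamma].  This is applied in the free algebra to
      the pair [(x, w)], with [y] as middle element ([chain_terms_jonsson]).
    - The resulting chain of terms is a sequence of Jonsson terms, and
      Jonsson's argument passes from the composition of two factors to
      compositions of any length, that is, to the join
      ([jonsson_distributive]). *)

Set Implicit Arguments.
Unset Strict Implicit.
Unset Printing Implicit Defensive.

Local Open Scope classical_set_scope.

(** * Compatible relations and alternating compositions *)

Definition compatible (Sg : signature) (A : algebra Sg) (R : set (A * A)) :
    Prop :=
  forall (f : symb Sg) (a b : 'I_(arity f) -> A),
    (forall i, R (a i, b i)) -> R (interp a, interp b).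

Lemma rcompP (T : Type) (R S : set (T * T)) (a b : T) :
  rcomp R S (a, b) <-> exists2 c, R (a, c) & S (c, b).
Proof. by []. Qed.

Lemma compatible_eval (Sg : signature) (A : algebra Sg) (R : set (A * A))
    (X : Type) (v v' : X -> A) (t : term Sg X) :
  compatible R -> (forall x, R (v x, v' x)) -> R (eval v t, eval v' t).
Proof.
move=> cR Rv; elim: t => [x|f args IH] /=.
  exact: Rv.
exact: cR.
Qed.

Lemma compatible_app4 (Sg : signature) (A : algebra Sg) (R : set (A * A))
    (t : term4 Sg) (x y z w x' y' z' w' : A) :
  compatible R -> R (x, x') -> R (y, y') -> R (z, z') -> R (w, w') ->
  R (app4 t x y z w, app4 t x' y' z' w').
Proof. by move=> cR *; apply: compatible_eval => // -[]. Qed.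

Lemma compatible_diagonal (Sg : signature) (A : algebra Sg) :
  compatible (@diagonal A).
Proof. by move=> f a b E; apply/diagonalP; congr interp; apply/funext. Qed.

Lemma congruence_diagonal (Sg : signature) (A : algebra Sg) :
  congruence (@diagonal A).
Proof.
split=> [//|a b /diagonalP->|a b c /diagonalP->|] //.
exact: compatible_diagonal.
Qed.

Lemma compatible_rcomp (Sg : signature) (A : algebra Sg) (R S : set (A * A)) :
  compatible R -> compatible S -> compatible (rcomp R S).
Proof.
move=> cR cS f a b RSab.
have /choice [c Pc] : forall i, exists c, R (a i, c) /\ S (c, b i).
  by move=> i; have /rcompP[c] := RSab i; exists c.
by apply/rcompP; exists (interp c); [apply: cR | apply: cS] => i; case: (Pc i).
Qed.

Lemma compatible_rcomp_alt (Sg : signature) (A : algebra Sg)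
    (R S : set (A * A)) (n : nat) :
  compatible R -> compatible S -> compatible (rcomp_alt R S n).
Proof.
elim: n R S => [|n IH] R S cR cS; first exact: compatible_diagonal.
exact: compatible_rcomp (cR) (IH _ _ cS cR).
Qed.

Lemma congruenceI (Sg : signature) (A : algebra Sg) (R S : set (A * A)) :
  congruence R -> congruence S -> congruence (R `&` S).
Proof.
move=> [Rr Rs Rt Rc] [Sr Ss St Sc].
split=> [//|a b []|a b c [Rab Sab] [Rbc Sbc]|f a b H].
- by split; [apply: Rs | apply: Ss].
- by split; [apply: Rt Rab Rbc | apply: St Sab Sbc].
- by split; [apply: Rc | apply: Sc] => i; case: (H i).
Qed.

Lemma rcomp_altSP (T : Type) (R S : set (T * T)) (n : nat) (a b : T) :
  rcomp_alt R S n.+1 (a, b) <-> exists2 c, R (a, c) & rcomp_alt S R n (c, b).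
Proof. by []. Qed.

Lemma rcomp_alt_sub (T : Type) (R S R' S' : set (T * T)) (n : nat) :
  R `<=` R' -> S `<=` S' -> rcomp_alt R S n `<=` rcomp_alt R' S' n.
Proof.
elim: n R S R' S' => [|n IH] R S R' S' sR sS [a b]; first by [].
move=> /rcomp_altSP[c Rac Scb].
apply/rcomp_altSP; exists c; first exact: sR.
exact: (IH _ _ _ _ sS sR _ Scb).
Qed.

Lemma rcomp_alt_le (T : Type) (R S : set (T * T)) (m n : nat) :
  (forall a, R (a, a)) -> (forall a, S (a, a)) -> m <= n ->
  rcomp_alt R S m `<=` rcomp_alt R S n.
Proof.
elim: n m R S => [|n IH] [|m] R S Rr Sr le_mn [a b] //.
  move=> /diagonalP<-.
  by apply/rcomp_altSP; exists a => //; apply: (IH 0 _ _ Sr Rr).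
move=> /rcomp_altSP[c Rac Scb]; apply/rcomp_altSP; exists c => //.
exact: (IH _ _ _ Sr Rr le_mn _ Scb).
Qed.

Lemma rcomp_alt_sub_trans (T : Type) (R S Q : set (T * T)) (n : nat) :
  (forall a, Q (a, a)) -> (forall a b c, Q (a, b) -> Q (b, c) -> Q (a, c)) ->
  R `<=` Q -> S `<=` Q -> rcomp_alt R S n `<=` Q.
Proof.
move=> Qr Qt; elim: n R S => [|n IH] R S sR sS [a b].
  by move=> /diagonalP<-.
by move=> /rcomp_altSP[c /sR Qac /(IH _ _ sS sR)]; exact: Qt Qac.
Qed.

Lemma rcomp_altP (T : Type) (R S : set (T * T)) (n : nat) (a b : T) :
  rcomp_alt R S n (a, b) <->
  exists e : nat -> T, [/\ e 0 = a, e n = b &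
    forall i, i < n -> (if odd i then S else R) (e i, e i.+1)].
Proof.
split.
  elim: n R S a => [|n IH] R S a; first by move=> /diagonalP<-; exists (fun=> a).
  move=> /rcomp_altSP[c Rac /IH [e [e0 en eP]]].
  exists (fun i => if i is j.+1 then e j else a); split=> // -[_|i lt_in] /=.
    by rewrite e0.
  by have := eP i lt_in; case: (odd i).
elim: n R S a => [|n IH] R S a [e [e0 en eP]].
  by apply/diagonalP; rewrite -e0 -en.
apply/rcomp_altSP; exists (e 1); first by have := eP 0 isT; rewrite e0.
apply: IH; exists (e \o succn); split=> // i lt_in.
by have := eP i.+1 lt_in => /=; case: (odd i).
Qed.

(** * Generated congruences *)

Lemma congruence_Cg (Sg : signature) (A : algebra Sg) (E : set (A * A)) :
  congruence (Cg E).
Proof.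
split=> [a Q [[Qr _ _ _] _] //|a b H Q [cQ EQ]|a b c H K Q [cQ EQ]|
  f a b H Q [cQ EQ]].
- by case: (cQ) => _ + _ _; apply; apply: H.
- by case: (cQ) => _ _ + _; apply; [apply: H | apply: K].
- by case: (cQ) => _ _ _; apply=> i; apply: H.
Qed.

Lemma sub_Cg (Sg : signature) (A : algebra Sg) (E : set (A * A)) :
  E `<=` Cg E.
Proof. exact: sub_smallest. Qed.

Lemma Cg_sub (Sg : signature) (A : algebra Sg) (E Q : set (A * A)) :
  congruence Q -> E `<=` Q -> Cg E `<=` Q.
Proof. by move=> cQ EQ p; apply; split. Qed.

Lemma Cg_hom (Sg : signature) (A B : algebra Sg) (h : A -> B)
    (E : set (A * A)) (Q : set (B * B)) (p q : A) :
  hom h -> congruence Q -> (forall r, E r -> Q (h r.1, h r.2)) ->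
  Cg E (p, q) -> Q (h p, h q).
Proof.
move=> hh [Qr Qs Qt Qc] EQ; apply: (@Cg_sub _ _ _ [set r | Q (h r.1, h r.2)]) => //.
split=> /= [a|a b|a b c|f a b H]; [exact: Qr|exact: Qs|exact: Qt|].
by rewrite !hh; apply: Qc.
Qed.

Lemma cong_join_subl (Sg : signature) (A : algebra Sg) (R S : set (A * A)) :
  R `<=` cong_join R S.
Proof. by move=> r Rr; apply: sub_Cg; left. Qed.

Lemma cong_join_subr (Sg : signature) (A : algebra Sg) (R S : set (A * A)) :
  S `<=` cong_join R S.
Proof. by move=> r Sr; apply: sub_Cg; right. Qed.

Lemma rcomp_alt_join (Sg : signature) (A : algebra Sg) (R S : set (A * A))
    (n : nat) :
  rcomp_alt R S n `<=` cong_join R S.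
Proof.
have [Jr _ Jt _] := congruence_Cg (R `|` S).
by apply: rcomp_alt_sub_trans => //; [exact: cong_join_subl|exact: cong_join_subr].
Qed.

(** Every alternating composition is compatible and they form a chain under
    inclusion; as the operations are finitary, their union is a congruence. *)
Lemma cong_join_alt (Sg : signature) (A : algebra Sg) (R S : set (A * A))
    (a b : A) :
  congruence R -> congruence S ->
  cong_join R S (a, b) -> exists n, rcomp_alt R S n (a, b).
Proof.
move=> cR cS; pose U (R S : set (A * A)) := [set r | exists n, rcomp_alt R S n r].
suff cU : congruence (U R S).
  apply: (Cg_sub cU) => -[c d] [Rcd|Scd].
    by exists 1; apply/rcomp_altSP; exists d.
  exists 2; apply/rcomp_altSP; exists c; first by case: cR.
  by apply/rcomp_altSP; exists d.
have Uswap R1 S1 : congruence R1 -> U S1 R1 `<=` U R1 S1.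
  move=> [R1r _ _ _] [c d] [n Hn]; exists n.+1.
  by apply/rcomp_altSP; exists c.
have Ut R1 S1 c d e : congruence R1 -> congruence S1 ->
    U R1 S1 (c, d) -> U R1 S1 (d, e) -> U R1 S1 (c, e).
  move=> cR1 cS1 [m]; elim: m R1 S1 cR1 cS1 c => [|m IH] R1 S1 cR1 cS1 c.
    by move=> /diagonalP<-.
  move=> /rcomp_altSP[c' Rcc' Hm] /(Uswap _ _ cS1) Hde.
  have [p Hp] := IH _ _ cS1 cR1 _ Hm Hde.
  by exists p.+1; apply/rcomp_altSP; exists c'.
have [Rr Rs _ Rc] := cR; have [Sr Ss _ Sc] := cS.
split.
- by move=> c; exists 0.
- move=> c d [n]; elim: n R S cR cS {Rr Rs Rc Sr Ss Sc} c => [|n IH] R1 S1 cR1 cS1 c.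
    by move=> /diagonalP<-; exists 0.
  move=> /rcomp_altSP[c' Rcc' Hn]; apply: (Ut _ _ _ c') => //.
    by apply: Uswap => //; apply: IH Hn.
  exists 1; apply/rcomp_altSP; exists c => //.
  by case: cR1 => _ + _ _; apply.
- by move=> c d e; apply: Ut.
- move=> f c d /choice [n Hn]; exists (\max_i n i).
  apply: compatible_rcomp_alt => // i.
  by apply: (rcomp_alt_le Rr Sr (leq_bigmax i)); exact: Hn.
Qed.

(** * The free algebra *)

Lemma congruence_identities (Sg : signature) (V : variety Sg) (X : Type) :
  congruence (@identities Sg V X).
Proof.
split=> [//|s t st A VA v|s t u st tu A VA v|f s t st A VA v].
- by have /= -> := st A VA v.
- by have /= -> := st A VA v; apply: tu.
- by rewrite /=; congr interp; apply/funext => i; apply: st.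
Qed.

Definition free_ext (Sg : signature) (V : variety Sg) (X : Type)
    (A : algebra Sg) (v : X -> A) (p : free_algebra V X) : A :=
  eval v (class_rep p).

Lemma free_ext_class (Sg : signature) (V : variety Sg) (X : Type)
    (A : algebra Sg) (v : X -> A) (t : term_algebra Sg X) :
  V A -> free_ext v (class (@identities Sg V X) t) = eval v t.
Proof.
move=> VA; have cI := congruence_identities V X.
have /(classP _ _ cI) H := class_repK (class (@identities Sg V X) t).
exact: H A VA v.
Qed.

Lemma free_ext_gen (Sg : signature) (V : variety Sg) (X : Type)
    (A : algebra Sg) (v : X -> A) (x : X) :
  V A -> free_ext v (free_gen V x) = v x.
Proof. exact: (free_ext_class v (Var x)). Qed.

Lemma hom_free_ext (Sg : signature) (V : variety Sg) (X : Type)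
    (A : algebra Sg) (v : X -> A) :
  V A -> hom (@free_ext Sg V X A v).
Proof. by move=> VA f p; rewrite [LHS]free_ext_class. Qed.

(** Each pair of terms which is not an identity of [V] fails in some member of
    [V]; the free algebra embeds in the product of these members.  Indexing by
    pairs of terms, and not by the members of [V], keeps the index a type. *)
Lemma variety_free (Sg : signature) (V : variety Sg) (X : Type) (x0 : X) :
  V (free_algebra V X).
Proof.
pose I := {st : term Sg X * term Sg X | ~ @identities Sg V X st}.
have sepP (i : I) : exists Av : {A : algebra Sg & X -> A},
    V (projT1 Av) /\
    eval (projT2 Av) (sval i).1 <> eval (projT2 Av) (sval i).2.
  case: i => st nst; apply: contrapT => H; apply: (nst) => A VA v.
  by apply: contrapT => ne; apply: H; exists (existT _ A v).
have [Av AvP] := choice sepP.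
pose h (p : free_algebra V X) : prod_algebra (fun i => projT1 (Av i)) :=
  fun i => free_ext (projT2 (Av i)) p.
apply: (@variety_sub _ V _ _ h); last 2 first.
- exact: (inhabits (free_gen V x0)).
- by apply: variety_prod => i; case: (AvP i).
- move=> f p; apply: functional_extensionality_dep => i.
  by apply: hom_free_ext; case: (AvP i).
- move=> p q hpq; rewrite -[p]class_repK -[q]class_repK.
  apply/classP; first exact: congruence_identities.
  apply: contrapT => npq.
  have [_] := AvP (exist _ (class_rep p, class_rep q) npq); apply.
  exact: (congr1 (fun g => g (exist _ (class_rep p, class_rep q) npq)) hpq).
Qed.

Definition val4 (T : Type) (a b c d : T) (l : letter) : T :=
  match l with lx => a | ly => b | lz => c | lw => d end.

Lemma free_ext_Cg (Sg : signature) (V : variety Sg) (A : algebra Sg)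
    (v : letter -> A) (E : set (F4 V * F4 V)) (p q : F4 V) :
  V A -> (forall r, E r -> free_ext v r.1 = free_ext v r.2) ->
  Cg E (p, q) -> free_ext v p = free_ext v q.
Proof.
move=> VA HE Hpq; apply/diagonalP.
by apply: Cg_hom (hom_free_ext v VA) (congruence_diagonal A) _ Hpq => r /HE.
Qed.

(** * The Maltsev condition *)

(** The terms are representatives of the elements of the chain.  The
    substitutions in (b), (c) and (d) identify the generating pairs of [beta],
    [alpha] and [gamma] respectively, so the kernel of the corresponding
    homomorphism contains that congruence. *)
Lemma chain_terms_of_rcomp_alt (Sg : signature) (V : variety Sg) (k : nat) :
  let x := free_gen V lx in
  let y := free_gen V ly in
  let z := free_gen V lz in
  let w := free_gen V lw in
  @rcomp_alt (F4 V) (Cg [set (x, w)] `&` Cg [set (x, y); (z, w)])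
    (Cg [set (y, z)]) k (x, w) ->
  exists d : nat -> term4 Sg, chain_terms V k d.
Proof.
move=> x y z w /rcomp_altP [e [e0 ek eP]].
exists (fun i => class_rep (e i)) => A VA a b c d.
have extE i a' b' c' d' : app4 (class_rep (e i)) a' b' c' d' =
    free_ext (val4 a' b' c' d') (e i) by [].
split=> [|i ik ei|i ik ei|i ik oi|]; rewrite !extE ?e0 ?ek ?free_ext_gen //.
- have := eP i ik; rewrite (negbTE ei) => -[_].
  by apply: free_ext_Cg => // r [] -> /=; rewrite !free_ext_gen.
- have := eP i ik; rewrite (negbTE ei) => -[+ _].
  by apply: free_ext_Cg => // r -> /=; rewrite !free_ext_gen.
- have := eP i ik; rewrite oi.
  by apply: free_ext_Cg => // r -> /=; rewrite !free_ext_gen.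
Qed.

Lemma star_special_chain_terms (Sg : signature) (V : variety Sg) (k : nat) :
  star_special V k -> exists d : nat -> term4 Sg, chain_terms V k d.
Proof.
move=> Hs; apply: chain_terms_of_rcomp_alt; apply: Hs; split.
  exact: sub_Cg.
apply/rcompP; exists (free_gen V ly); first by apply: sub_Cg; left.
apply/rcompP; exists (free_gen V lz); first exact: sub_Cg.
by apply: sub_Cg; right.
Qed.

Lemma chain_terms_star (Sg : signature) (V : variety Sg) (k : nat)
    (d : nat -> term4 Sg) (A : algebra Sg) :
  chain_terms V k d -> V A -> star_holds_in A k.
Proof.
move=> Hd VA al be ga cal cbe cga [a w] [alaw].
move=> /rcompP[b beab /rcompP[c gabc becw]].
have [alr als alt_ alc] := cal; have [ber bes bet bec] := cbe.
have [gar gas gat gac] := cga.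
have [d0 _ _ _ dk] := Hd A VA a b c w.
apply/rcomp_altP; exists (fun i => app4 (d i) a b c w); split=> // i ik.
case: ifP => oi.
  have [_ _ _ + _] := Hd A VA a b c w => /(_ i ik oi) E.
  apply: (gat _ (app4 (d i) a b b w)); last rewrite E;
    by apply: compatible_app4 => //; apply: gas.
have ei : ~~ odd i by rewrite oi.
split.
  have [_ _ + _ _] := Hd A VA a b c w => /(_ i ik ei) E.
  apply: (alt_ _ (app4 (d i) a b c a)); last rewrite E;
    by apply: compatible_app4 => //; apply: als.
have [_ + _ _ _] := Hd A VA a b c w => /(_ i ik ei) E.
apply: (bet _ (app4 (d i) a a w w)); last rewrite E;
  by apply: compatible_app4 => //; apply: bes.
Qed.

(** * Modularity *)

Lemma chain_terms_day (Sg : signature) (V : variety Sg) (k : nat)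
    (d : nat -> term4 Sg) (A : algebra Sg) (a b : A) (i : nat) :
  chain_terms V k d -> V A -> i <= k -> app4 (d i) a b b a = a.
Proof.
move=> Hd VA; have [d0 _ dc dd _] := Hd A VA a b b a.
elim: i => [//|i IH] ik; rewrite -[RHS](IH (ltnW ik)).
by case: (boolP (odd i)) => oi; apply: esym; [apply: dd | apply: dc].
Qed.

(** Inductive step of Day's argument.  The elements [d_i(a,b,c,w)] lead from
    [a] to [w]; those for odd [i] and [i+1] are linked in [delta], and for even
    [i] one passes through [d_i(a,a,w,w)], which is [T]-related and, by the Day
    equation and [delta <= alpha], also [alpha]-related to [d_i(a,b,c,w)]. *)
Lemma chain_terms_day_step (Sg : signature) (V : variety Sg) (k : nat)
    (d : nat -> term4 Sg) (A : algebra Sg) (alpha delta rho T : set (A * A)) :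
  chain_terms V k d -> V A ->
  congruence alpha -> congruence delta -> congruence rho ->
  delta `<=` alpha -> delta `<=` rho ->
  (forall a, T (a, a)) -> (forall a b, T (a, b) -> T (b, a)) -> compatible T ->
  alpha `&` T `<=` rho -> alpha `&` rcomp T (rcomp delta T) `<=` rho.
Proof.
move=> Hd VA cal cde crh de_al de_rh Tr Ts Tc IH [a w] [alaw].
move=> /rcompP[b Tab /rcompP[c debc Tcw]].
have [alr als alt_ alc] := cal; have [der des det dec] := cde.
have [rhr rhs rht rhc] := crh.
have [d0 _ _ _ dk] := Hd A VA a b c w.
pose u i := app4 (d i) a b c w; pose v i := app4 (d i) a a w w.
have alau i : i <= k -> alpha (a, u i).
  move=> ik; rewrite -{1}(chain_terms_day a b Hd VA ik).
  by apply: compatible_app4 => //; apply: de_al.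
have alav i : i <= k -> alpha (a, v i).
  move=> ik; rewrite -{1}(chain_terms_day a a Hd VA ik).
  exact: compatible_app4.
have rhuv i : i <= k -> rho (u i, v i).
  move=> ik; apply: IH; split.
    by apply: (alt_) (als _ _ (alau i ik)) (alav i ik).
  by apply: compatible_app4 => //; apply: Ts.
suff rhu i : i <= k -> rho (a, u i) by rewrite -dk; apply: rhu.
elim: i => [|i IHi] ik; first by rewrite /u -d0.
apply: (rht) (IHi (ltnW ik)) _.
have [_ db _ dd _] := Hd A VA a b c w.
case: (boolP (odd i)) => oi; last first.
  apply: (rht) (rhuv i (ltnW ik)) _; rewrite /v (db i ik oi).
  exact: rhs (rhuv i.+1 ik).
apply: de_rh; apply: (det _ (app4 (d i) a b b w)); last rewrite (dd i ik oi);
  by apply: compatible_app4 => //; apply: des.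
Qed.

(** The symmetric relations [T_0 = gamma], [T_(n+1) = T_n o delta o T_n] exhaust
    the join of [delta] and [gamma]; symmetry is what the inductive step needs,
    and what the alternating compositions lack when their length is even. *)
Lemma chain_terms_modular (Sg : signature) (V : variety Sg) (k : nat)
    (d : nat -> term4 Sg) (A : algebra Sg) (alpha delta gamma : set (A * A)) :
  chain_terms V k d -> V A ->
  congruence alpha -> congruence delta -> congruence gamma ->
  delta `<=` alpha ->
  alpha `&` cong_join delta gamma `<=` cong_join delta (alpha `&` gamma).
Proof.
move=> Hd VA cal cde cga de_al [a w] [alaw Jaw].
have [der des det dec] := cde; have [gar gas gat gac] := cga.
pose T n := iter n (fun T => rcomp T (rcomp delta T)) gamma.
have Tr n c : T n (c, c).
  elim: n => [|n IHn]; first exact: gar.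
  by apply/rcompP; exists c => //; apply/rcompP; exists c.
have Ts n c c' : T n (c, c') -> T n (c', c).
  elim: n c c' => [|n IHn] c c'; first exact: gas.
  move=> /rcompP[p Tcp /rcompP[q depq Tqc']].
  apply/rcompP; exists q; first exact: IHn.
  by apply/rcompP; exists p; [apply: des | apply: IHn].
have Tc n : compatible (T n).
  by elim: n => [//|n IHn]; do 2![apply: compatible_rcomp => //].
have gaT n : gamma `<=` T n.
  elim: n => [//|n IHn] [c c'] /IHn Tcc'.
  apply/rcompP; exists c' => //; apply/rcompP; exists c'; first exact: der.
  exact: Tr.
have altT n : rcomp_alt delta gamma n `<=` T n /\ rcomp_alt gamma delta n `<=` T n.
  elim: n => [|n [IH1 IH2]]; first by split=> -[c c'] /diagonalP<-; apply: Tr.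
  split=> -[c c'] /rcomp_altSP[p Hp Hq].
    apply/rcompP; exists c; first exact: Tr.
    by apply/rcompP; exists p => //; apply: IH2.
  apply/rcompP; exists p; first exact: gaT.
  by apply/rcompP; exists p => //; apply: IH1.
have Trho n : alpha `&` T n `<=` cong_join delta (alpha `&` gamma).
  elim: n => [|n IHn]; first exact: cong_join_subr.
  exact: (chain_terms_day_step Hd VA cal cde (congruence_Cg _) de_al
    (@cong_join_subl _ _ _ _) (Tr n) (Ts n) (Tc n) IHn).
have [n Haw] := cong_join_alt cde cga Jaw.
by apply: (Trho n); split=> //; case: (altT n) => + _; apply.
Qed.

(** * Distributivity *)

Lemma chain_terms_jonsson (Sg : signature) (V : variety Sg) (k : nat)
    (d : nat -> term4 Sg) :
  let x := free_gen V lx in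
  let y := free_gen V ly in
  let w := free_gen V lw in
  chain_terms V k d ->
  @cong_join Sg (F4 V) (Cg [set (x, w)] `&` Cg [set (x, y)])
    (Cg [set (x, w)] `&` Cg [set (y, w)]) (x, w).
Proof.
move=> x y w Hd; have VF : V (F4 V) := variety_free V lx.
have al := @congruence_Cg Sg (F4 V) [set (x, w)].
have be := @congruence_Cg Sg (F4 V) [set (x, y)].
have ga := @congruence_Cg Sg (F4 V) [set (y, w)].
have alxw : @Cg Sg (F4 V) [set (x, w)] (x, w) by apply: sub_Cg.
have alI := congruenceI al be.
apply: (chain_terms_modular Hd VF al alI ga); first by move=> r [].
split=> //; apply: (@rcomp_alt_join _ _ _ _ k).
apply: (chain_terms_star Hd VF) => //; split=> //.
apply/rcompP; exists y; first exact: sub_Cg.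
apply/rcompP; exists w; first exact: sub_Cg.
by case: be.
Qed.

(** Jonsson's argument.  For an [alpha]-related pair [(a, d)] and an element
    [c], let [phi c] be the homomorphism [x, y, z, w |-> a, c, c, d].  If [p] is
    congruent to [x] modulo [Cg(x,w)], then [phi c p] is [alpha]-related to [a]
    for all [c]; so, moving [c] along a chain from [a] to [d], all the [phi c p]
    are related in the right-hand join.  The hypothesis gives a
    chain from [x] to [w] in the free algebra, each step of which is collapsed
    by [phi a] or by [phi d]. *)
Lemma jonsson_distributive (Sg : signature) (V : variety Sg) :
  let x := free_gen V lx in
  let y := free_gen V ly in
  let w := free_gen V lw in
  @cong_join Sg (F4 V) (Cg [set (x, w)] `&` Cg [set (x, y)])
    (Cg [set (x, w)] `&` Cg [set (y, w)]) (x, w) ->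
  congruence_distributive V.
Proof.
move=> x y w Jxw A VA al be ga cal cbe cga.
have [alr als alt_ alc] := cal.
set rho := cong_join (al `&` be) (al `&` ga).
have crho : congruence rho := congruence_Cg _.
have [rhr rhs rht rhc] := crho.
apply/seteqP; split; last first.
  apply: Cg_sub; first exact: congruenceI cal (congruence_Cg _).
  move=> r [[alr_ ber]|[alr_ gar]]; split=> //.
    exact: cong_join_subl.
  exact: cong_join_subr.
move=> [a d] [alad Jad].
have [n /rcomp_altP [c [c0 cn cP]]] := cong_join_alt cbe cga Jad.
pose phi c := @free_ext Sg V letter A (val4 a c c d).
have homphi c' : hom (phi c') by apply: hom_free_ext.
have alphi c' p : @Cg Sg (F4 V) [set (x, w)] (x, p) -> al (a, phi c' p).
  move=> Hp; have -> : a = phi c' x by rewrite /phi free_ext_gen.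
  apply: Cg_hom (homphi c') cal _ Hp => r ->.
  by rewrite /phi !free_ext_gen.
have phi_step (Q : set (A * A)) c1 c2 p : congruence Q -> al `&` Q `<=` rho ->
    Q (c1, c2) -> @Cg Sg (F4 V) [set (x, w)] (x, p) -> rho (phi c1 p, phi c2 p).
  move=> cQ Qrho Q12 Hp; apply: Qrho; split.
    exact: alt_ (als _ _ (alphi _ _ Hp)) (alphi _ _ Hp).
  have [Qr _ _ Qc] := cQ.
  by apply: compatible_eval => // -[].
have phi_ad p : @Cg Sg (F4 V) [set (x, w)] (x, p) -> rho (phi a p, phi d p).
  move=> Hp; rewrite -{1}c0 -{1}cn.
  suff H i : i <= n -> rho (phi (c 0) p, phi (c i) p) by apply: H.
  elim: i => [//|i IHi] lt_in; apply: (rht) (IHi (ltnW lt_in)) _.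
  have := cP i lt_in; case: (odd i) => Hi; apply: phi_step Hi Hp => //.
    exact: cong_join_subr.
  exact: cong_join_subl.
have [_ aS aT _] := @congruence_Cg Sg (F4 V) [set (x, w)].
have [m /rcomp_altP [e [e0 em eP]]] := cong_join_alt
  (congruenceI (@congruence_Cg Sg (F4 V) [set (x, w)])
     (@congruence_Cg Sg (F4 V) [set (x, y)]))
  (congruenceI (@congruence_Cg Sg (F4 V) [set (x, w)])
     (@congruence_Cg Sg (F4 V) [set (y, w)])) Jxw.
suff He i : i <= m ->
    @Cg Sg (F4 V) [set (x, w)] (x, e i) /\ rho (a, phi a (e i)).
  have [_] := He m (leqnn m); rewrite em /phi free_ext_gen //.
elim: i => [_|i IHi lt_im].
  by rewrite e0 /phi free_ext_gen //; split=> //; case: (congruence_Cg [set (x, w)]).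
have [ali rhi] := IHi (ltnW lt_im).
(* a step in [Cg(x,y)] is collapsed by [phi a], one in [Cg(y,w)] by [phi d] *)
have := eP i lt_im; case: (odd i) => -[alii Hi];
    (have alSi := aT _ _ _ ali alii); split=> //; apply: (rht) rhi _; last first.
  have -> : phi a (e i) = phi a (e i.+1) by
    apply: free_ext_Cg Hi => // r -> /=; rewrite !free_ext_gen.
  exact: rhr.
apply: (rht) (phi_ad _ ali) _.
have -> : phi d (e i) = phi d (e i.+1) by
  apply: free_ext_Cg Hi => // r -> /=; rewrite !free_ext_gen.
exact: rhs (phi_ad _ alSi).
Qed.

Lemma distributive_chain_terms (Sg : signature) (V : variety Sg) :
  congruence_distributive V ->
  exists k : nat, 0 < k /\ exists d : nat -> term4 Sg, chain_terms V k d.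
Proof.
move=> CD; pose x := free_gen V lx; pose y := free_gen V ly.
pose z := free_gen V lz; pose w := free_gen V lw.
have VF : V (F4 V) := variety_free V lx.
have cal := @congruence_Cg Sg (F4 V) [set (x, w)].
have cbe := @congruence_Cg Sg (F4 V) [set (x, y); (z, w)].
have cga := @congruence_Cg Sg (F4 V) [set (y, z)].
have [n Hn] : exists n, @rcomp_alt (F4 V)
    (Cg [set (x, w)] `&` Cg [set (x, y); (z, w)])
    (Cg [set (x, w)] `&` Cg [set (y, z)]) n (x, w).
  apply: cong_join_alt; [exact: congruenceI..|].
  rewrite -(CD (F4 V) VF _ _ _ cal cbe cga); split; first exact: sub_Cg.
  apply: (@rcomp_alt_join _ _ _ _ 3).
  apply/rcompP; exists y; first by apply: sub_Cg; left.
  apply/rcompP; exists z; first exact: sub_Cg.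
  by apply/rcompP; exists w => //; apply: sub_Cg; right.
(* one more factor, as [n] may be 0 *)
exists n.+1; split=> //; apply: chain_terms_of_rcomp_alt.
have [ar _ _ _] := cal; have [br _ _ _] := cbe; have [gr _ _ _] := cga.
apply: (rcomp_alt_le _ _ (leqnSn n)) => //.
by apply: (rcomp_alt_sub _ _ Hn) => // r [].
Qed.

Theorem corollary2 (Sg : signature) (V : variety Sg) :
  (forall k : nat, 0 < k ->
    [/\ (forall A : algebra Sg, V A -> star_holds_in A k)
          <-> star_holds_in (F4 V) k,
        star_holds_in (F4 V) k <-> star_special V k
      & star_special V k <-> exists d : nat -> term4 Sg, chain_terms V k d])
  /\
  [/\ congruence_distributive V <->
        exists k : nat, 0 < k /\
          forall A : algebra Sg, V A -> star_holds_in A k,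
      congruence_distributive V <->
        exists k : nat, 0 < k /\ star_holds_in (F4 V) k,
      congruence_distributive V <->
        exists k : nat, 0 < k /\ star_special V k
    & congruence_distributive V <->
        exists k : nat, 0 < k /\
          exists d : nat -> term4 Sg, chain_terms V k d].
Proof.
have all_F4 k : (forall A : algebra Sg, V A -> star_holds_in A k) ->
    star_holds_in (F4 V) k by apply; apply: variety_free lx.
have F4_special k : star_holds_in (F4 V) k -> star_special V k.
  by apply; apply: congruence_Cg.
have special_terms := @star_special_chain_terms Sg V.
have terms_all k : (exists d, chain_terms V k d) ->
    forall A : algebra Sg, V A -> star_holds_in A k.
  by move=> [d Hd] A; apply: chain_terms_star Hd.
have CD_terms := @distributive_chain_terms Sg V.
have terms_CD : (exists k, 0 < k /\ exists d, chain_terms V k d) ->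
    congruence_distributive V.
  by move=> [k [_ [d Hd]]]; apply: jonsson_distributive (chain_terms_jonsson Hd).
split=> [k _|]; first by split; split; auto.
split; split=> [/CD_terms [k [k0 H]]|[k [k0 H]]];
  by [exists k; split; auto | apply: terms_CD; exists k; split; auto].
Qed.
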